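(* Let $p,q$ be two integers and let $n$ be a positive integer. Let $G^{p,q}_n=g^{p,q}_n+g^{p,q}_{n+1}i+g^{p,q}_{n+2}j+g^{p,q}_{n+3}k$ be the $n$-th generalized Fibonacci-Lucas quaternion in $\mathbb{H}_{\mathbb{Z}_5}(-1,-1)$. Then: (i) if $p\equiv 0\pmod 5$, then $G^{p,q}_n$ is a zero divisor in $\mathbb{H}_{\mathbb{Z}_5}(-1,-1)$ (for every $n$); (ii) if $5\nmid p$ and $p\equiv q\pmod 5$, then $G^{p,q}_n$ is a zero divisor in $\mathbb{H}_{\mathbb{Z}_5}(-1,-1)$ if and only if $n\equiv 4\pmod 5$; (iii) if $5\nmid p$ and $p+q\equiv 0\pmod 5$, then $G^{p,q}_n$ is a zero divisor in $\mathbb{H}_{\mathbb{Z}_5}(-1,-1)$ if and only if $n\equiv 0\pmod 5$; (iv) if $(p,q)$ is congruent modulo $5$ to one of $(1,2),(3,1),(2,4),(4,3)$, then $G^{p,q}_n$ is a zero divisor in $\mathbb{H}_{\mathbb{Z}_5}(-1,-1)$ if and only if $n\equiv 1\pmod 5$; (v) if $(p,q)$ is congruent modulo $5$ to one of $(2,1),(3,4),(4,2),(1,3)$, then $G^{p,q}_n$ is a zero divisor in $\mathbb{H}_{\mathbb{Z}_5}(-1,-1)$ if and only if $n\equiv 3\pmod 5$; (vi) if $5\nmid p$ and $q\equiv 0\pmod 5$, then $G^{p,q}_n$ is a zero divisor in $\mathbb{H}_{\mathbb{Z}_5}(-1,-1)$ if and only if $n\equiv 2\pmod 5$.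
   Context: $(f_n)_{n\ge 0}$ is the Fibonacci sequence ($f_0=0$, $f_1=1$, $f_n=f_{n-1}+f_{n-2}$ for $n\ge2$) and $(l_n)_{n\ge 0}$ the Lucas sequence ($l_0=2$, $l_1=1$, $l_n=l_{n-1}+l_{n-2}$ for $n\ge2$). For integers $p,q$ the generalized Fibonacci-Lucas numbers are $g^{p,q}_{n+1}=p f_n+q\, l_{n+1}$, $n\ge 0$. For a prime $r$, $\mathbb{Z}_r=\mathbb{Z}/r\mathbb{Z}$, and $\mathbb{H}_{\mathbb{Z}_r}(-1,-1)$ is the 4-dimensional associative unital $\mathbb{Z}_r$-algebra with basis $\{1,i,j,k\}$ and relations $i^2=j^2=-1$, $k=ij=-ji$. Integer coefficients are reduced modulo $r$. An element $x$ of a ring is a zero divisor if there is a nonzero $y$ with $xy=0$ or $yx=0$ (so $0$ counts as a zero divisor). *)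

(* Defs.v *)
From HB Require Import structures.
From mathcomp Require Import all_boot all_order all_algebra.
From mathcomp Require Import ring.

Set Implicit Arguments.
Unset Strict Implicit.
Unset Printing Implicit Defensive.

Import GRing.Theory.
Local Open Scope ring_scope.

(* The algebra H_R(a, b) with i^2 = a, j^2 = b and k = ij = -ji, represented by
   the coordinates on the basis 1, i, j, k. *)
Record quaternion (R : Type) (a b : R) :=
  Quaternion { quat1 : R; quati : R; quatj : R; quatk : R }.
Arguments Quaternion {R a b}.

Section QuaternionAlgebra.
Variables (R : comNzRingType) (a b : R).
Local Notation H := (quaternion a b).

Definition tuple_of_quat (x : H) : R * R * R * R :=
  (quat1 x, quati x, quatj x, quatk x).
Definition quat_of_tuple (t : R * R * R * R) : H :=
  let: (x1, x2, x3, x4) := t in Quaternion x1 x2 x3 x4.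
Lemma tuple_of_quatK : cancel tuple_of_quat quat_of_tuple.
Proof. by case. Qed.

HB.instance Definition _ := Choice.copy H (can_type tuple_of_quatK).

Definition addq (x y : H) : H :=
  Quaternion (quat1 x + quat1 y) (quati x + quati y)
             (quatj x + quatj y) (quatk x + quatk y).
Definition oppq (x : H) : H :=
  Quaternion (- quat1 x) (- quati x) (- quatj x) (- quatk x).
Definition mulq (x y : H) : H :=
  let: Quaternion x1 x2 x3 x4 := x in
  let: Quaternion y1 y2 y3 y4 := y in
  Quaternion (x1 * y1 + a * (x2 * y2) + b * (x3 * y3) - a * b * (x4 * y4))
             (x1 * y2 + x2 * y1 - b * (x3 * y4) + b * (x4 * y3))
             (x1 * y3 + x3 * y1 + a * (x2 * y4) - a * (x4 * y2))
             (x1 * y4 + x4 * y1 + x2 * y3 - x3 * y2).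
Definition scaleq (c : R) (x : H) : H :=
  Quaternion (c * quat1 x) (c * quati x) (c * quatj x) (c * quatk x).

Fact addqA : associative addq.
Proof. by case=> ? ? ? ? [? ? ? ?] [? ? ? ?]; rewrite /addq /= !addrA. Qed.
Fact addqC : commutative addq.
Proof. by case=> ? ? ? ? [? ? ? ?]; congr Quaternion; rewrite /= addrC. Qed.
Fact add0q : left_id (Quaternion 0 0 0 0) addq.
Proof. by case=> ? ? ? ?; rewrite /addq /= !add0r. Qed.
Fact addNq : left_inverse (Quaternion 0 0 0 0) oppq addq.
Proof. by case=> ? ? ? ?; rewrite /addq /= !addNr. Qed.

HB.instance Definition _ := GRing.isZmodule.Build H addqA addqC add0q addNq.

Fact mulqA : associative mulq.
Proof. by case=> ? ? ? ? [? ? ? ?] [? ? ? ?]; congr Quaternion; ring. Qed.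
Fact mul1q : left_id (Quaternion 1 0 0 0) mulq.
Proof. by case=> ? ? ? ?; congr Quaternion; ring. Qed.
Fact mulq1 : right_id (Quaternion 1 0 0 0) mulq.
Proof. by case=> ? ? ? ?; congr Quaternion; ring. Qed.
Fact mulqDl : left_distributive mulq +%R.
Proof. by case=> ? ? ? ? [? ? ? ?] [? ? ? ?]; congr Quaternion => /=; ring. Qed.
Fact mulqDr : right_distributive mulq +%R.
Proof. by case=> ? ? ? ? [? ? ? ?] [? ? ? ?]; congr Quaternion => /=; ring. Qed.
Fact oneq_neq0 : Quaternion 1 0 0 0 != 0 :> H.
Proof. by apply/eqP => -[] /eqP; rewrite oner_eq0. Qed.

HB.instance Definition _ :=
  GRing.Zmodule_isNzRing.Build H mulqA mul1q mulq1 mulqDl mulqDr oneq_neq0.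

Fact scaleqA c d x : scaleq c (scaleq d x) = scaleq (c * d) x.
Proof. by rewrite /scaleq /= !mulrA. Qed.
Fact scale1q : left_id 1 scaleq.
Proof. by case=> ? ? ? ?; rewrite /scaleq /= !mul1r. Qed.
Fact scaleqDr : right_distributive scaleq +%R.
Proof. by move=> c x y; congr Quaternion; rewrite /= mulrDr. Qed.
Fact scaleqDl x : {morph scaleq^~ x : c d / c + d}.
Proof. by move=> c d; congr Quaternion; rewrite /= mulrDl. Qed.

HB.instance Definition _ :=
  GRing.Zmodule_isLmodule.Build R H scaleqA scale1q scaleqDr scaleqDl.

Fact scaleqAl (c : R) (x y : H) : c *: (x * y) = (c *: x) * y.
Proof. by case: x y => ? ? ? ? [? ? ? ?]; congr Quaternion => /=; ring. Qed.

HB.instance Definition _ := GRing.Lmodule_isLalgebra.Build R H scaleqAl.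

Fact scaleqAr (c : R) (x y : H) : c *: (x * y) = x * (c *: y).
Proof. by case: x y => ? ? ? ? [? ? ? ?]; congr Quaternion => /=; ring. Qed.

HB.instance Definition _ := GRing.Lalgebra_isAlgebra.Build R H scaleqAr.

Definition qi : H := Quaternion 0 1 0 0.
Definition qj : H := Quaternion 0 0 1 0.
Definition qk : H := Quaternion 0 0 0 1.

Lemma qi_sqr : qi * qi = a%:A.
Proof. by congr Quaternion => /=; ring. Qed.
Lemma qj_sqr : qj * qj = b%:A.
Proof. by congr Quaternion => /=; ring. Qed.
Lemma qij : qi * qj = qk.
Proof. by congr Quaternion; ring. Qed.
Lemma qji : qj * qi = - qk.
Proof. by congr Quaternion => /=; ring. Qed.

Lemma quatE (x1 x2 x3 x4 : R) :
  x1%:A + x2 *: qi + x3 *: qj + x4 *: qk = Quaternion x1 x2 x3 x4 :> H.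
Proof. by congr Quaternion => /=; ring. Qed.

End QuaternionAlgebra.

Definition zero_divisor (R : pzRingType) (x : R) : Prop :=
  exists2 y : R, y != 0 & x * y = 0 \/ y * x = 0.

Fixpoint fib (n : nat) : nat :=
  if n is (n'.+1 as m).+1 then (fib m + fib n')%N else n.

Fixpoint lucas (n : nat) : nat :=
  match n with
  | 0 => 2
  | 1 => 1
  | (n'.+1 as m).+1 => lucas m + lucas n'
  end%N.

(* The sequence starts at index 1, with g_{n+1} = p f_n + q l_{n+1}; the value
   at index 0 is irrelevant. *)
Definition gen_fib_lucas (p q : int) (n : nat) : int :=
  p * (fib n.-1)%:Z + q * (lucas n)%:Z.

Definition gen_fib_lucas_quat (R : comNzRingType) (p q : int) (n : nat) :
    quaternion (- 1 : R) (- 1) :=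
  let g m : R := (gen_fib_lucas p q m)%:~R in
  (g n)%:A + g n.+1 *: qi _ _ + g n.+2 *: qj _ _ + g n.+3 *: qk _ _.

(* Main.v *)
Require Import Defs.
From mathcomp Require Import all_boot all_order all_algebra.
From mathcomp Require Import ring.
Local Open Scope ring_scope.
Import GRing.Theory.

(** Since x conj(x) = conj(x) x = N(x) is a scalar, a quaternion over a field is a
    zero divisor exactly when its norm vanishes ([zero_divisorP]).  For a = b = -1
    the norm is the sum of the squared coordinates, so the question is when a sum of four consecutive squares g_n^2 + ... + g_{n+3}^2 is 0 mod 5.

    The prime 5 is special because it is the discriminant of X^2 - X - 1, which
    becomes (X - 3)^2 over 'F_5.  A sequence satisfying the Fibonacci recurrence
    therefore has the form 3^m (A m + B), and matching initial values gives
    g_{m+1} = 3^m (2 m p + q) ([gen_fib_lucas_F5]).  Moreover the sum of four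
    consecutive squares, as a quadratic form in the first two terms s and t,
    splits over 'F_5 as (t - s)(t - 3 s) ([fib_sum_squares]); the second factor
    kills the part proportional to 3^m and only sees p.  The outcome is

      N(G_n) = +- p ((n - 2) p - 2 q)   in 'F_5    ([normq_gen_fib_lucas]).

    If 5 divides p this vanishes for every n.  Otherwise it vanishes exactly
    when n = 2 + 2 q / p in 'F_5, and all the congruence classes of the theorem
    are values of that one expression. *)

Section Norm.
Variables (F : fieldType) (a b : F).
Implicit Types x y : quaternion a b.

Definition conjq x : quaternion a b :=
  Quaternion (quat1 x) (- quati x) (- quatj x) (- quatk x).

Definition normq x : F :=
  quat1 x ^+ 2 - a * quati x ^+ 2 - b * quatj x ^+ 2 + a * b * quatk x ^+ 2.

Lemma mulq_conj x : x * conjq x = (normq x)%:A.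
Proof. by case: x => *; congr Quaternion; rewrite /normq /=; ring. Qed.

Lemma mulq_conjl x : conjq x * x = (normq x)%:A.
Proof. by case: x => *; congr Quaternion; rewrite /normq /=; ring. Qed.

Lemma conjq_eq0 x : conjq x = 0 -> x = 0.
Proof.
case: x => x1 x2 x3 x4 [-> e2 e3 e4].
by congr Quaternion; apply: oppr_inj; rewrite oppr0.
Qed.

(** A nonzero norm makes conj x / N(x) an inverse of x, while a zero norm makes
    conj x itself an annihilator of x. *)
Lemma zero_divisorP x : zero_divisor x <-> normq x = 0.
Proof.
split=> [[y y0 xy0] | N0].
  have /eqP : normq x *: y = 0.
    case: xy0 => h.
      by rewrite -mulr_algl -mulq_conjl -mulrA h mulr0.
    by rewrite -mulr_algr -mulq_conj mulrA h mul0r.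
  by rewrite scaler_eq0 (negPf y0) orbF => /eqP.
have [-> | x0] := eqVneq x 0.
  by exists 1; [exact: oner_neq0 | left; rewrite mul0r].
exists (conjq x); last by left; rewrite mulq_conj N0 scale0r.
by apply/eqP => /conjq_eq0/eqP; rewrite (negPf x0).
Qed.

End Norm.

Arguments normq {F a b}.
Arguments zero_divisorP {F a b}.

(** The ring identities below hold only modulo 5: each is proved by adding an
    explicit multiple of 5 that makes it an identity over the integers. *)
Lemma five_eq0 : 5 = 0 :> 'F_5.
Proof. exact: val_inj. Qed.

Lemma gen_fib_lucas_rec (R : pzRingType) p q m :
  (gen_fib_lucas p q m.+3)%:~R =
  (gen_fib_lucas p q m.+2)%:~R + (gen_fib_lucas p q m.+1)%:~R :> R.
Proof.
by rewrite -intrD; congr _%:~R; rewrite /gen_fib_lucas /= !PoszD; ring.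
Qed.

Lemma gen_fib_lucas_F5 p q m :
  (gen_fib_lucas p q m.+1)%:~R =
  3 ^+ m * (2 * m%:R * p%:~R + q%:~R) :> 'F_5.
Proof.
suff [] : (gen_fib_lucas p q m.+1)%:~R =
            3 ^+ m * (2 * m%:R * p%:~R + q%:~R) :> 'F_5 /\
          (gen_fib_lucas p q m.+2)%:~R =
            3 ^+ m.+1 * (2 * m.+1%:R * p%:~R + q%:~R) :> 'F_5 by [].
elim: m => [|m [IH1 IH2]].
  rewrite /gen_fib_lucas /= mulr0 mulr1 add0r rmorphD !rmorphM /=.
  split; first by ring.
  transitivity (3 * (2 * p%:~R + q%:~R) - 5 * p%:~R : 'F_5); first by ring.
  by rewrite five_eq0; ring.
split=> //; rewrite gen_fib_lucas_rec IH1 IH2.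
set P := p%:~R; set Q := q%:~R; set e := 3 ^+ m.
(* X^2 - X - 1 and its derivative 2 X - 1 both take the value 5 at X = 3, which
   is why the solutions 3^m and m 3^m both fit up to a multiple of 5 *)
transitivity (3 ^+ m.+2 * (2 * m.+2%:R * P + Q)
              - 5 * (e * (2 * m%:R * P + Q + 6 * P)) : 'F_5).
  by rewrite !exprS -/e -(natr1 m.+1) -(natr1 m); ring.
by rewrite five_eq0; ring.
Qed.

(** For the terms s, t, t + s, 2 t + s the sum of squares is the quadratic form
    3 s^2 + 6 s t + 6 t^2, congruent to t^2 - 4 s t + 3 s^2 = (t - s)(t - 3 s).
    The factor t - s is the term preceding s, and t - 3 s vanishes on 3^m. *)
Lemma fib_sum_squares (s t : 'F_5) :
  s ^+ 2 + t ^+ 2 + (t + s) ^+ 2 + (t + s + t) ^+ 2 = (t - s) * (t - 3 * s).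
Proof.
transitivity ((t - s) * (t - 3 * s) + 5 * (t ^+ 2 + 2 * s * t)); first by ring.
by rewrite five_eq0; ring.
Qed.

Lemma normq_gen_fib_lucas p q n : (0 < n)%N ->
  normq (gen_fib_lucas_quat 'F_5 p q n) =
  (-1) ^+ n * (p%:~R * ((n%:R - 2) * p%:~R - 2 * q%:~R)).
Proof.
case: n => // m _; rewrite /gen_fib_lucas_quat quatE /normq /=.
transitivity (let g k : 'F_5 := (gen_fib_lucas p q k)%:~R in
  g m.+1 ^+ 2 + g m.+2 ^+ 2 + g m.+3 ^+ 2 + g m.+4 ^+ 2); first by rewrite /=; ring.
rewrite /= !gen_fib_lucas_rec fib_sum_squares !gen_fib_lucas_F5.
have -> : (-1) ^+ m.+1 = (3 ^+ m.+1) ^+ 2 :> 'F_5.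
  by rewrite -exprM mulnC exprM; congr (_ ^+ _); apply: val_inj.
rewrite exprS -(natr1 m).
set P := p%:~R; set Q := q%:~R; set e : 'F_5 := 3 ^+ m.
transitivity ((3 * e) ^+ 2 * (P * ((m%:R + 1 - 2) * P - 2 * Q))
              + 5 * (e ^+ 2 * P * (3 * m%:R * P + 6 * Q + 9 * P))).
  by ring.
by rewrite five_eq0; ring.
Qed.

Lemma natr_F5P n c : n%:R = c%:R :> 'F_5 <-> n = c %[mod 5].
Proof.
by split=> [/(congr1 val) | h]; last apply: val_inj; rewrite /= !val_Fp_nat.
Qed.

Lemma intr_F5_eq0 p : (p%:~R == 0 :> 'F_5) = (5 %| p)%Z.
Proof. by rewrite (dvdz_pcharf (pchar_Fp (isT : prime 5))). Qed.

Lemma intr_F5 p q : (p = q %[mod 5])%Z -> p%:~R = q%:~R :> 'F_5.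
Proof.
move/eqP; rewrite eqz_mod_dvd -intr_F5_eq0 rmorphB subr_eq0.
by move/eqP.
Qed.

(** For invertible p, the norm formula is linear in n, with root 2 + 2 q / p. *)
Lemma zero_divisor_gen_fib_lucas p q n c : (0 < n)%N -> p%:~R != 0 :> 'F_5 ->
    2 + 2 * q%:~R / p%:~R = c%:R :> 'F_5 ->
  zero_divisor (gen_fib_lucas_quat 'F_5 p q n) <-> n = c %[mod 5].
Proof.
move=> n_gt0 p0 Ec.
rewrite zero_divisorP normq_gen_fib_lucas // -natr_F5P -Ec.
have -> : (n%:R - 2) * p%:~R - 2 * q%:~R =
          p%:~R * (n%:R - (2 + 2 * q%:~R / p%:~R)) :> 'F_5 by field.
split=> [/eqP | ->]; last by rewrite subrr !mulr0.
by rewrite !mulf_eq0 signr_eq0 (negPf p0) /= subr_eq0 => /eqP.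
Qed.

Theorem proposition3p4 (p q : int) (n : nat) (n_gt0 : (0 < n)%N) :
  let G : quaternion (- 1 : 'F_5) (- 1) := gen_fib_lucas_quat 'F_5 p q n in
  ((p = 0 %[mod 5])%Z -> zero_divisor G) /\
  (~~ (5 %| p)%Z -> (p = q %[mod 5])%Z ->
     (zero_divisor G <-> n = 4 %[mod 5])) /\
  (~~ (5 %| p)%Z -> (p + q = 0 %[mod 5])%Z ->
     (zero_divisor G <-> n = 0 %[mod 5])) /\
  ([\/ (p = 1 %[mod 5])%Z /\ (q = 2 %[mod 5])%Z,
       (p = 3 %[mod 5])%Z /\ (q = 1 %[mod 5])%Z,
       (p = 2 %[mod 5])%Z /\ (q = 4 %[mod 5])%Z |
       (p = 4 %[mod 5])%Z /\ (q = 3 %[mod 5])%Z] ->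
     (zero_divisor G <-> n = 1 %[mod 5])) /\
  ([\/ (p = 2 %[mod 5])%Z /\ (q = 1 %[mod 5])%Z,
       (p = 3 %[mod 5])%Z /\ (q = 4 %[mod 5])%Z,
       (p = 4 %[mod 5])%Z /\ (q = 2 %[mod 5])%Z |
       (p = 1 %[mod 5])%Z /\ (q = 3 %[mod 5])%Z] ->
     (zero_divisor G <-> n = 3 %[mod 5])) /\
  (~~ (5 %| p)%Z -> (q = 0 %[mod 5])%Z ->
     (zero_divisor G <-> n = 2 %[mod 5])).
Proof.
move=> G; rewrite {}/G; split=> [/intr_F5 p0|].
  by apply/zero_divisorP; rewrite normq_gen_fib_lucas // p0 mul0r mulr0.
rewrite -intr_F5_eq0; split=> [p0 /intr_F5 pq|].
  apply: zero_divisor_gen_fib_lucas => //; rewrite -pq mulfK //.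
  exact: val_inj.
split=> [p0 /intr_F5|].
  rewrite rmorphD /= => /eqP; rewrite addrC addr_eq0 => /eqP pq.
  apply: zero_divisor_gen_fib_lucas => //; rewrite pq mulrN mulNr mulfK //.
  exact: val_inj.
split=> [H|].
  have {H} [] : p%:~R != 0 :> 'F_5 /\ 2 + 2 * q%:~R / p%:~R = 1%:R :> 'F_5.
    by case: H => -[/intr_F5-> /intr_F5->]; split=> //; apply: val_inj.
  exact: zero_divisor_gen_fib_lucas.
split=> [H|p0 /intr_F5 q0].
  have {H} [] : p%:~R != 0 :> 'F_5 /\ 2 + 2 * q%:~R / p%:~R = 3%:R :> 'F_5.
    by case: H => -[/intr_F5-> /intr_F5->]; split=> //; apply: val_inj.
  exact: zero_divisor_gen_fib_lucas.
apply: zero_divisor_gen_fib_lucas => //.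
by rewrite q0 mulr0 mul0r addr0.
Qed.
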